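(* Let $0<\varepsilon<1$. In the distributed tracking model with $k$ sites, universe $[n]$ and total stream length $m=\mathrm{poly}(n)$, there is a randomized tracking protocol (the paper's $\ell_2$ heavy hitter tracking algorithm) which maintains at the coordinator estimates $\hat v_j(t)$ such that for every time $t\in[m]$ and every $j\in[n]$, with constant probability, $|v_j(t)-\hat v_j(t)|\le \varepsilon\,\ell_2'(t)$. Its expected total communication cost is $O\!\left(\frac{k}{\varepsilon^2}\log^3 n\right)$ bits.
   Context: Distributed tracking model: each site $i\in[k]$ receives over time a stream of items from $[n]$ (insertions only); $v_{ij}(t)$ is the number of copies of $j$ received by site $i$ up to time $t$, and $v_j(t)=\sum_{i=1}^k v_{ij}(t)$. The coordinator must be able to output estimates at every time step; communication cost is the total number of bits exchanged between the coordinator and the sites over the whole stream. $\ell_2'(t)=\big(\sum_{i=1}^k\sum_{j=1}^n v_{ij}(t)^2\big)^{1/2}$. *)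

(* Defs.v *)
From mathcomp Require Import all_boot all_order all_algebra.
From mathcomp Require Import reals.

Set Implicit Arguments.
Unset Strict Implicit.
Unset Printing Implicit Defensive.

Import Order.TTheory GRing.Theory Num.Theory.
Local Open Scope ring_scope.

Section Stream.
Variables (R : realType) (k n : nat).

(* The a-th entry (i, j) of a stream says that the item received in the whole
   system at time a.+1 is j, and that it is received by site i; the items seen
   up to time t are thus those of take t s. *)
Definition stream := seq ('I_k * 'I_n).

Definition site_freq (s : stream) (t : nat) (i : 'I_k) (j : 'I_n) : nat :=
  count_mem (i, j) (take t s).

Definition freq (s : stream) (t : nat) (j : 'I_n) : nat :=
  (\sum_(i < k) site_freq s t i j)%N.

Definition ell2' (s : stream) (t : nat) : R :=
  Num.sqrt (\sum_(i < k) \sum_(j < n) (site_freq s t i j)%:R ^+ 2).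

End Stream.

Definition msg := seq bool.

(* Randomness is private: party None is the coordinator, party Some i is
   site i, and each draws its whole supply of random coins at the start,
   independently of the others, from its own law. Apart from that draw every
   party is deterministic.
   A party is woken up only by an item (sites) or by a message; in particular
   no party has access to a global clock. The empty bit string stands for "no
   message": it is never delivered, so it conveys nothing.
   [hops] bounds the number of messages delivered between two arrivals; see
   [settles]. *)
Record protocol (R : realType) (k n : nat) := Protocol {
  coin : finType;
  law : option 'I_k -> coin -> R;
  law_ge0 : forall p x, 0 <= law p x;
  law_sum1 : forall p, \sum_x law p x = 1;
  site_state : Type;
  coord_state : Type;
  site_init : 'I_k -> coin -> site_state;
  coord_init : coin -> coord_state;
  site_on_item : 'I_k -> site_state -> 'I_n -> site_state * msg;
  site_on_msg : 'I_k -> site_state -> msg -> site_state * msg;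
  coord_on_msg :
    coord_state -> 'I_k -> msg -> coord_state * seq ('I_k * msg);
  estimate : coord_state -> 'I_n -> R;
  hops : nat
}.

Inductive packet (k : nat) := Up of 'I_k & msg | Down of 'I_k & msg.

Definition payload (k : nat) (p : packet k) : msg :=
  match p with Up _ x => x | Down _ x => x end.

Section Execution.
Variables (R : realType) (k n : nat) (P : protocol R k n).

(* [pending] is the FIFO queue of the messages in transit; [bits] is the number
   of bits sent so far, in both directions. *)
Record config := Config {
  sites : 'I_k -> site_state P;
  coord : coord_state P;
  pending : seq (packet k);
  bits : nat
}.

Definition set_site (f : 'I_k -> site_state P) (i : 'I_k) (x : site_state P) :=
  fun i' => if i' == i then x else f i'.

Definition send (c : config) (ps : seq (packet k)) : config :=
  Config (sites c) (coord c)
    (pending c ++ [seq p <- ps | payload p != [::]])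
    (bits c + sumn [seq size (payload p) | p <- ps])%N.

Definition arrive (c : config) (a : 'I_k * 'I_n) : config :=
  let: (i, j) := a in
  let: (x, up) := site_on_item i (sites c i) j in
  send (Config (set_site (sites c) i x) (coord c) (pending c) (bits c))
    [:: Up i up].

Definition deliver (c : config) : config :=
  match pending c with
  | [::] => c
  | Up i y :: q =>
      let: (z, downs) := coord_on_msg (coord c) i y in
      send (Config (sites c) z q (bits c)) [seq Down d.1 d.2 | d <- downs]
  | Down i y :: q =>
      let: (x, up) := site_on_msg i (sites c i) y in
      send (Config (set_site (sites c) i x) (coord c) q (bits c)) [:: Up i up]
  end.

Definition step (c : config) (a : 'I_k * 'I_n) : config :=
  iter (hops P) deliver (arrive c a).

Definition tape := {ffun option 'I_k -> coin P}.

Definition start (w : tape) : config :=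
  Config (fun i => site_init i (w (Some i))) (coord_init (w None)) [::] 0.

Definition run (w : tape) (s : stream k n) : config := foldl step (start w) s.

(* Communication is instantaneous: the exchange triggered by an arrival is over
   before the next arrival. *)
Definition settles (s : stream k n) : Prop :=
  forall (w : tape) (t : nat), pending (run w (take t s)) = [::].

Definition mass (w : tape) : R := \prod_p law p (w p).

Definition Pr (A : pred tape) : R := \sum_(w | A w) mass w.

Definition Ex (X : tape -> R) : R := \sum_w mass w * X w.

Definition estimate_at (w : tape) (s : stream k n) (t : nat) (j : 'I_n) : R :=
  estimate (coord (run w (take t s))) j.

Definition cost (w : tape) (s : stream k n) : nat := bits (run w s).

End Execution.

(* Main.v *)
(* Communication is one-way and the sites act independently. When the item j
   reaches site i, raising its local count to v and the local sum of squared
   counts to f, the site reports (j, v, f) with probability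
   q = min(1, lam v / f), and the coordinator adds 1/q to its estimate of v_j.
   The estimate is unbiased. Its variance is at most the sum of f / (lam v) over
   the arrivals of j; as f only grows, this is at most
   ell2'^2 (1 + ln m) / lam, which is ell2'^2 eps^2 / 3 for
   lam = 3 (1 + ln m) / eps^2, and Chebyshev's inequality applies. The expected
   number of reports of a site is at most lam times the sum of v / f over its
   arrivals, hence at most lam (1 + ln f) for the final f since v is at most
   the increment 2 v - 1 of f. A report takes O(log n) bits. *)

Require Import Defs.
From mathcomp Require Import all_boot all_order all_algebra.
From mathcomp Require Import reals exp.
From mathcomp Require Import ring lra.

Import Order.TTheory GRing.Theory Num.Theory.
Local Open Scope ring_scope.

(** * Moments of independent Bernoulli coins indexed by [I * K] *)

Section ProductBernoulli.
Set Implicit Arguments.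
Unset Strict Implicit.
Variables (R : realType) (I K : finType) (q : I * K -> R).
Implicit Types (e : I * K) (w : {ffun I -> {ffun K -> bool}}).

Definition bernoulli (p : R) (b : bool) : R := if b then p else 1 - p.

Definition weight w : R := \prod_i \prod_x bernoulli (q (i, x)) (w i x).

Lemma sum_prod_ffun (F : I * K -> bool -> R) :
  \sum_(w : {ffun I -> {ffun K -> bool}}) \prod_i \prod_x F (i, x) (w i x) =
  \prod_e (F e true + F e false).
Proof.
rewrite -(bigA_distr_bigA (fun i (y : {ffun K -> bool}) =>
  \prod_x F (i, x) (y x))) /=.
transitivity (\prod_i \prod_x (F (i, x) true + F (i, x) false)); last first.
  by rewrite pair_bigA; apply: eq_bigr => -[].
apply: eq_bigr => i _; rewrite -(bigA_distr_bigA (fun x => F (i, x))) /=.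
by apply: eq_bigr => x _; rewrite big_bool.
Qed.

(** Each indicator is absorbed into the factor of its own coin; a factor then sums to [q e] inside
    [S] and to 1 outside. The total mass and the first and second moments are the cases of [S]
    empty, a singleton and a pair. *)
Lemma sum_weight_subset (S : {set I * K}) :
  \sum_w weight w * (\prod_(e in S) (w e.1 e.2 : nat)%:R) = \prod_(e in S) q e.
Proof.
pose F e b : R := bernoulli (q e) b * (if e \in S then (b : nat)%:R else 1).
transitivity (\sum_(w : {ffun I -> {ffun K -> bool}})
  \prod_i \prod_x F (i, x) (w i x)).
  apply: eq_bigr => w _; rewrite /weight (big_mkcond (fun e => e \in S)) /=.
  rewrite !pair_bigA -big_split /=.
  by apply: eq_bigr => -[i x] _ /=; rewrite /F.
rewrite sum_prod_ffun [RHS]big_mkcond; apply: eq_bigr => e _.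
by rewrite /F /bernoulli; case: ifP => _; rewrite ?mulr1 ?mulr0 ?addr0 // addrC subrK.
Qed.

Lemma sum_weight : \sum_w weight w = 1.
Proof.
have := sum_weight_subset set0; rewrite big_set0 => <-.
by apply: eq_bigr => w _; rewrite big_set0 mulr1.
Qed.

Lemma sum_weight_hit e : \sum_w weight w * (w e.1 e.2 : nat)%:R = q e.
Proof.
have := sum_weight_subset [set e]; rewrite big_set1 => <-.
by apply: eq_bigr => w _; rewrite big_set1.
Qed.

Lemma sum_weight_hit2 e e' : e != e' ->
  \sum_w weight w * ((w e.1 e.2 : nat)%:R * (w e'.1 e'.2 : nat)%:R) = q e * q e'.
Proof.
move=> ne; have := sum_weight_subset [set e; e'].
rewrite big_setU1 ?inE //= big_set1 => <-.
by apply: eq_bigr => w _; rewrite big_setU1 ?inE //= big_set1.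
Qed.

(** Distinct coins are independent and each centred term has mean 0; on the diagonal an indicator
    equals its square, so its second moment is [q e]. *)
Lemma sum_weight_covariance e e' :
  q e != 0 -> q e' != 0 ->
  \sum_w weight w * (((w e.1 e.2 : nat)%:R / q e - 1) *
                     ((w e'.1 e'.2 : nat)%:R / q e' - 1)) =
  if e == e' then (q e)^-1 - 1 else 0.
Proof.
move=> qe qe'.
transitivity (\sum_w (weight w * ((w e.1 e.2 : nat)%:R * (w e'.1 e'.2 : nat)%:R)
     * (q e)^-1 / q e' - weight w * (w e.1 e.2 : nat)%:R / q e
     - weight w * (w e'.1 e'.2 : nat)%:R / q e' + weight w)).
  by apply: eq_bigr => w _; ring.
rewrite big_split /= !sumrB -!mulr_suml !sum_weight_hit sum_weight !divff //.
case: eqVneq => [<-|ne].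
  have -> : \sum_w weight w * ((w e.1 e.2 : nat)%:R * (w e.1 e.2 : nat)%:R) = q e.
    rewrite -[RHS]sum_weight_hit; apply: eq_bigr => w _.
    by case: (w _ _); rewrite ?mulr1 ?mulr0.
  by rewrite divff // mul1r; ring.
by rewrite sum_weight_hit2 //; field; rewrite qe qe'.
Qed.

Lemma sum_weight_square (l : seq (I * K)) :
  uniq l -> {in l, forall e, q e != 0} ->
  \sum_w weight w * (\sum_(e <- l) ((w e.1 e.2 : nat)%:R / q e - 1)) ^+ 2 =
  \sum_(e <- l) ((q e)^-1 - 1).
Proof.
move=> ul ql.
under eq_bigr => w _ do rewrite expr2 big_distrlr mulr_sumr /=.
rewrite exchange_big /= big_seq [RHS]big_seq; apply: eq_bigr => e el.
under eq_bigr => w _ do rewrite mulr_sumr.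
rewrite exchange_big /=.
rewrite (eq_big_seq (fun e' => if e == e' then (q e)^-1 - 1 else 0)); last first.
  by move=> e' e'l; rewrite sum_weight_covariance ?ql.
rewrite (bigD1_seq e) //= eqxx big1 ?addr0 // => e' ne.
by rewrite eq_sym (negbTE ne).
Qed.

End ProductBernoulli.

(** * Chebyshev's inequality on a finite probability space *)

Section Chebyshev.
Set Implicit Arguments.
Unset Strict Implicit.
Variables (R : realType) (T : finType) (mu : T -> R).
Hypotheses (mu_ge0 : forall w, 0 <= mu w) (mu1 : \sum_w mu w = 1).

Lemma chebyshev_finite (X : T -> R) (d c : R) :
  0 < d -> \sum_w mu w * X w ^+ 2 <= c * d ^+ 2 ->
  1 - c <= \sum_(w | `|X w| <= d) mu w.
Proof.
move=> d0 Xc.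
rewrite lerBlDr -mu1 (bigID (fun w => `|X w| <= d)) /= lerD2l.
rewrite -(ler_pM2r (exprn_gt0 2 d0)); apply: le_trans Xc.
rewrite [leRHS](bigID (fun w => `|X w| <= d)) /= mulr_suml.
apply: ler_wpDl.
  by apply: sumr_ge0 => w _; rewrite mulr_ge0 ?sqr_ge0.
apply: ler_sum => w; rewrite -ltNge => dX.
rewrite ler_wpM2l // -[X w ^+ 2]real_normK ?num_real //.
by rewrite ler_sqr ?nnegrE ?normr_ge0 ?ltW.
Qed.

End Chebyshev.

(** * Logarithmic bounds for harmonic sums and for code lengths *)

Section Harmonic.
Variable R : realType.

(** An upper bound for the harmonic numbers. The value 0 at 0 lets the telescoping of [harm_step]
    start from an empty history. *)
Definition harm (a : nat) : R := if a == 0%N then 0 else 1 + ln a%:R.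

(** For positive [a] this is [ln x <= x - 1] at [x = a / b]; for [a = 0] the left side is 1. *)
Lemma harm_step (a b : nat) :
  (a < b)%N -> (b - a)%:R / b%:R <= harm b - harm a.
Proof.
move=> ab; have b0 : (0 < b)%N by apply: leq_ltn_trans ab.
have bR : 0 < b%:R :> R by rewrite ltr0n.
rewrite /harm eqn0Ngt b0 /=; case: eqVneq => [->|a0].
  by rewrite subn0 subr0 divff ?lt0r_neq0 // lerDl ln_ge0 // ler1n.
have aR : 0 < a%:R :> R by rewrite ltr0n lt0n.
have : ln (1 + (a%:R / b%:R - 1) : R) <= a%:R / b%:R - 1.
  by apply: le_ln1Dx; rewrite ltrBrDl subrr divr_gt0.
rewrite addrC subrK ln_div ?posrE // natrB ?(ltnW ab) // mulrBl divff ?lt0r_neq0 //.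
by lra.
Qed.

Lemma harm_homo : {homo harm : a b / (a <= b)%N >-> a <= b}.
Proof.
move=> a b; rewrite leq_eqVlt => /predU1P[->//|ab].
rewrite -subr_ge0; apply: le_trans (harm_step ab).
by rewrite divr_ge0 ?ler0n.
Qed.

Lemma harm_ge0 a : 0 <= harm a.
Proof. exact: (@harm_homo 0%N a). Qed.

Lemma harm_exp (n c a : nat) :
  (0 < n)%N -> (a <= n ^ c)%N -> harm a <= 1 + c%:R * ln n%:R.
Proof.
move=> n0 /harm_homo/le_trans; apply.
by rewrite /harm eqn0Ngt expn_gt0 n0 /= natrX lnXn ?ltr0n // mulr_natl.
Qed.

Lemma up_log2_le_ln (n : nat) :
  (1 < n)%N -> (up_log 2 n)%:R <= 4 * ln n%:R :> R.
Proof.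
move=> n1; have nR : 0 < n%:R :> R by rewrite ltr0n ltnW.
(* With [ln 2 >= 1/2], the predecessor of [up_log 2 n] is at most [2 ln n], and the remaining 1 is
   at most [2 ln n] too: hence the constant 4. *)
have ln2 : 1 <= 2 * ln 2 :> R.
  have := @harm_step 1 2 isT; rewrite /harm /= ln1 subSS subn0.
  by lra.
have le2 : ln 2 <= ln n%:R :> R by rewrite ler_ln ?posrE // ler_nat.
have u0 : (0 < up_log 2 n)%N by rewrite up_log_gt0.
have lt_n : (2 ^ (up_log 2 n).-1 <= n)%N by rewrite ltnW // up_log_gtn.
have : (up_log 2 n).-1%:R * ln 2 <= ln n%:R :> R.
  by rewrite mulr_natl -lnXn // -natrX ler_ln ?posrE ?ltr0n ?expn_gt0 ?ler_nat // ltnW.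
have -> : (up_log 2 n)%:R = (up_log 2 n).-1%:R + 1 :> R.
  by rewrite natr1 prednK.
have : 0 <= (up_log 2 n).-1%:R * (2 * ln 2 - 1) :> R.
  by rewrite mulr_ge0 ?ler0n // subr_ge0.
by lra.
Qed.

End Harmonic.

(** Ranks embed [T] into the words of length [b]. Decoding searches for a preimage, with [x0] as
    default on words that are not codes. *)
Lemma block_code (T : finType) (x0 : T) (b : nat) : (#|T| <= 2 ^ b)%N ->
  exists (enc : T -> msg) (dec : msg -> T),
    (forall x, size (enc x) = b) /\ cancel enc dec.
Proof.
move=> Tb; have Tb' : (#|T| <= #|{: b.-tuple bool}|)%N by rewrite card_tuple card_bool.
pose f (x : T) : b.-tuple bool := enum_val (widen_ord Tb' (enum_rank x)).
have f_inj : injective f.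
  by move=> x y /enum_val_inj/(congr1 val) /= /ord_inj/enum_rank_inj.
exists (fun x => tval (f x)), (fun y => odflt x0 [pick x | tval (f x) == y]); split.
  by move=> x; rewrite size_tuple.
move=> x /=; case: pickP => [y /eqP/val_inj/f_inj //|/(_ x)]; by rewrite eqxx.
Qed.

(** * Potential reports of a history: their rates, total rate and variance *)

Section Sampling.
Set Implicit Arguments.
Unset Strict Implicit.
Variables (R : realType) (k n m : nat) (lam : R).
Hypothesis lam_gt0 : 0 < lam.
Implicit Types (h : seq 'I_n) (i : 'I_k) (j : 'I_n) (r : seq ('I_k * 'I_n)).

Definition sqsum h : nat := (\sum_j count_mem j h ^ 2)%N.

Lemma sqsum_cons j h :
  sqsum (j :: h) = (sqsum h + (2 * count_mem j h).+1)%N.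
Proof.
rewrite /sqsum (bigD1 j) //= [X in _ = (X + _)%N](bigD1 j) //= eqxx.
rewrite (eq_bigr (fun j' => count_mem j' h ^ 2)%N) => [|j' ne].
  by rewrite /= add1n; ring.
by rewrite eq_sym (negbTE ne).
Qed.

Lemma sqsum_size h : (sqsum h <= size h ^ 2)%N.
Proof.
elim: h => [|j h IH]; first by rewrite /sqsum big1.
rewrite sqsum_cons /= (_ : (_.+1 ^ 2 = size h ^ 2 + (2 * size h).+1)%N); last by ring.
by rewrite leq_add // ltnS leq_mul2l /= count_size.
Qed.

(* An item, its number of copies and the sum of the squared frequencies, all
   three at the reporting site and including the arrival reported. *)
Definition report := ('I_n * 'I_m.+1 * 'I_(m ^ 2).+1)%type.

(** [inord] falls back to 0 out of range; for histories shorter than [m] both numbers are in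
    range. *)
Definition report_of j h : report :=
  (j, inord (count_mem j (j :: h)), inord (sqsum (j :: h))).

Lemma report_count j h :
  (size h < m)%N -> (report_of j h).1.2 = (count_mem j h).+1 :> nat.
Proof.
by move=> hm; rewrite inordK /= eqxx ?ltnS // (leq_ltn_trans (count_size _ _)).
Qed.

Lemma report_sqsum j h :
  (size h < m)%N -> (report_of j h).2 = sqsum (j :: h) :> nat.
Proof.
by move=> hm; rewrite inordK // ltnS (leq_trans (sqsum_size _)) ?leq_sqr.
Qed.

(** A function of the report alone, so the coordinator can recompute from a message the probability
    with which it was sent. *)
Definition rate (x : report) : R := Num.min 1 (lam * x.1.2%:R / x.2%:R).

Lemma rate_ge0 x : 0 <= rate x.
Proof. by rewrite le_min ler01 divr_ge0 ?mulr_ge0 ?ler0n // ltW. Qed.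

Lemma rate_le1 x : rate x <= 1.
Proof. by rewrite ge_min lexx. Qed.

Lemma rate_le x : rate x <= lam * x.1.2%:R / x.2%:R.
Proof. by rewrite ge_min lexx orbT. Qed.

Lemma rate_gt0 (x : report) : (0 < x.1.2)%N -> (0 < x.2)%N -> 0 < rate x.
Proof. by move=> v0 f0; rewrite lt_min ltr01 divr_gt0 ?mulr_gt0 ?ltr0n. Qed.

(** The left side is the variance of a coin of bias [rate x] divided by its bias. It vanishes when
    the rate is capped at 1; otherwise the inverse rate is exactly the bound. *)
Lemma rate_variance (x : report) : (0 < x.1.2)%N -> (0 < x.2)%N ->
  (rate x)^-1 - 1 <= x.2%:R / x.1.2%:R / lam.
Proof.
move=> v0 f0; have vR : 0 < x.1.2%:R :> R by rewrite ltr0n.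
have fR : 0 < x.2%:R :> R by rewrite ltr0n.
rewrite /rate; case: (leP 1 (lam * _ / _)) => _.
  by rewrite invr1 subrr !divr_ge0 ?ltW.
apply: (@le_trans _ _ (lam * x.1.2%:R / x.2%:R)^-1).
  by rewrite lerBlDr lerDl ler01.
rewrite le_eqVlt; apply/predU1P; left.
by field; rewrite !lt0r_neq0.
Qed.

Definition local i r : seq 'I_n := [seq a.2 | a <- r & a.1 == i].

Lemma size_local i r : (size (local i r) <= size r)%N.
Proof. by rewrite size_map size_filter count_size. Qed.

Lemma local_cons i a r :
  local i (a :: r) = if a.1 == i then a.2 :: local i r else local i r.
Proof. by rewrite /local /=; case: ifP. Qed.

Lemma count_local i j r : count_mem j (local i r) = count_mem (i, j) r.
Proof.
rewrite count_map count_filter; apply: eq_count => -[i' j'] /=.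
by rewrite xpair_eqE andbC.
Qed.

(* Histories are in reverse order, the latest arrival first; the first
   component names the party that tosses the coin for the report. *)
Fixpoint reports r : seq (option 'I_k * report) :=
  if r is a :: r' then (Some a.1, report_of a.2 (local a.1 r')) :: reports r'
  else [::].

Lemma reports_bound r i j v f :
  (size r <= m)%N -> (Some i, (j, v, f)) \in reports r ->
  (v <= count_mem j (local i r))%N.
Proof.
elim: r => [|[i' j'] r IH] //= rm.
rewrite inE => /orP[/eqP[-> jj ev ef]|/IH le].
  have /= := @report_count j' (local i' r) (leq_ltn_trans (size_local _ _) rm).
  by rewrite ev jj local_cons /= !eqxx /= eqxx => ->.
rewrite local_cons; apply: leq_trans (le (ltnW rm)) _.
by case: ifP => //= _; rewrite leq_addl.
Qed.

Lemma reports_pos r e : (size r <= m)%N -> e \in reports r ->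
  (0 < e.2.1.2)%N /\ (0 < e.2.2)%N.
Proof.
elim: r => [|[i j] r IH] //= rm.
rewrite inE => /predU1P[->|er]; last exact: IH (ltnW rm) er.
have lm := leq_ltn_trans (size_local i r) rm.
by rewrite report_count // report_sqsum // sqsum_cons addnS.
Qed.

(** A new report of [j] by site [i] carries a count larger than all earlier ones for that pair.
    Different arrivals thus use different, hence independent, coins. *)
Lemma reports_uniq r : (size r <= m)%N -> uniq (reports r).
Proof.
elim: r => [|[i j] r IH] //= rm; rewrite IH ?(ltnW rm) // andbT.
apply/negP => /(reports_bound (ltnW rm)).
have /= -> := @report_count j (local i r) (leq_ltn_trans (size_local _ _) rm).
by rewrite ltnn.
Qed.

Lemma reports_count (j : 'I_n) r :
  \sum_(e <- reports r | e.2.1.1 == j) 1 = (\sum_i count_mem j (local i r))%:R :> R.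
Proof.
elim: r => [|[i0 j0] r IH] /=; first by rewrite big_nil big1.
rewrite big_cons /= IH (bigD1 i0) //= [in RHS](bigD1 i0) //= !local_cons eqxx /=.
rewrite [in RHS](eq_bigr (fun i => count_mem j (local i r))).
  by rewrite -[in RHS]addnA [in RHS]natrD; case: eqP => _; rewrite ?mulr0n ?add0r.
by move=> i /negbTE ne; rewrite local_cons eq_sym ne.
Qed.

Lemma reports_rate r : (size r <= m)%N ->
  \sum_(e <- reports r) rate e.2 <= lam * \sum_i harm R (sqsum (local i r)).
Proof.
elim: r => [|[i0 j0] r IH] /= rm.
  by rewrite big_nil mulr_ge0 ?(ltW lam_gt0) // sumr_ge0 // => i _; rewrite harm_ge0.
have lm := leq_ltn_trans (size_local i0 r) rm.
rewrite big_cons /= (bigD1 i0) //= local_cons eqxx /=.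
rewrite [X in _ * (_ + X)](eq_bigr (fun i => harm R (sqsum (local i r)))); last first.
  by move=> i /negbTE ne; rewrite local_cons eq_sym ne.
have := IH (ltnW rm); rewrite (bigD1 i0) //=.
set S := \sum_(i | _) _ => {}IH.
have := rate_le (report_of j0 (local i0 r)).
rewrite report_count // report_sqsum //.
set h := local i0 r in lm IH *; set f' := sqsum (j0 :: h).
have ff' : (sqsum h < f')%N by rewrite /f' sqsum_cons addnS ltnS leq_addr.
have := harm_step R ff'.
(* The increment of the sum of squares is [2 v - 1] for the new count [v], so [v / f'] is bounded by
   a step of [harm] and the sum telescopes. *)
have le_v : (count_mem j0 h).+1%:R <= (f' - sqsum h)%:R :> R.
  by rewrite /f' sqsum_cons addKn ler_nat ltnS leq_pmull.
have : (count_mem j0 h).+1%:R / f'%:R <= (f' - sqsum h)%:R / f'%:R :> R.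
  by rewrite ler_wpM2r ?invr_ge0 ?ler0n.
rewrite -mulrA => H1 H2 H3.
have : lam * ((count_mem j0 h).+1%:R / f'%:R) <= lam * (harm R f' - harm R (sqsum h)).
  by rewrite ler_wpM2l ?(ltW lam_gt0) // (le_trans H1).
by lra.
Qed.

(** The right side is a potential: every arrival at a site raises its [sqsum], and an arrival of [j]
    also raises [harm] of its count by at least the inverse of the new count, which pays for the new
    term. *)
Lemma reports_variance (j : 'I_n) r : (size r <= m)%N ->
  \sum_(e <- reports r | e.2.1.1 == j) ((rate e.2)^-1 - 1) <=
  (\sum_i (sqsum (local i r))%:R * harm R (count_mem j (local i r))) / lam.
Proof.
elim: r => [|[i0 j0] r IH] /= rm.
  rewrite big_nil divr_ge0 ?(ltW lam_gt0) // sumr_ge0 // => i _.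
  by rewrite mulr_ge0 ?ler0n ?harm_ge0.
have lm := leq_ltn_trans (size_local i0 r) rm.
rewrite big_cons /= [in leRHS](bigD1 i0) //= local_cons eqxx /=.
rewrite [X in (_ + X) / _](eq_bigr (fun i =>
  (sqsum (local i r))%:R * harm R (count_mem j (local i r)))); last first.
  by move=> i /negbTE ne; rewrite local_cons eq_sym ne.
have := IH (ltnW rm); rewrite [in leRHS](bigD1 i0) //=.
set S := \sum_(i | i != i0) _ => {}IH.
have := @rate_variance (report_of j0 (local i0 r)).
rewrite report_count // report_sqsum //.
set h := local i0 r in lm IH *; set f' := sqsum (j0 :: h).
have ff' : (sqsum h < f')%N by rewrite /f' sqsum_cons addnS ltnS leq_addr.
move=> /(_ isT (leq_ltn_trans (leq0n _) ff')).
set V := _^-1 - 1; set T := (\sum_(e <- _ | _) _) in IH *.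
have mono : (sqsum h)%:R * harm R (count_mem j h) <= f'%:R * harm R (count_mem j h).
  by rewrite ler_wpM2r ?harm_ge0 // ler_nat ltnW.
have lamV : 0 < lam^-1 by rewrite invr_gt0.
case: eqP => [->|ne] HV; last first.
  rewrite add0n; apply: le_trans IH _.
  by rewrite ler_wpM2r ?(ltW lamV) // lerD2r.
rewrite add1n.
have := @harm_step R (count_mem j h) _ (ltnSn _).
rewrite subSnn => H1.
have H2 : f'%:R / (count_mem j h).+1%:R <=
   f'%:R * (harm R (count_mem j h).+1 - harm R (count_mem j h)).
  by rewrite ler_wpM2l ?ler0n // -[_^-1]mul1r.
apply: (@le_trans _ _ (f'%:R / (count_mem j h).+1%:R / lam +
   ((sqsum h)%:R * harm R (count_mem j h) + S) / lam)); first exact: lerD.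
rewrite -mulrDl ler_wpM2r ?(ltW lamV) //.
move: H2; rewrite mulrBr lerBrDr => H2.
by rewrite addrA lerD2r (le_trans _ H2) // lerD2l.
Qed.

End Sampling.

(** * The protocol, its execution, cost and accuracy *)

Section Sampler.
Set Implicit Arguments.
Unset Strict Implicit.
Variables (R : realType) (k n m B : nat) (lam : R).
Hypotheses (lam_gt0 : 0 < lam) (B_gt0 : (0 < B)%N).
Variables (enc : report n m -> msg) (dec : msg -> report n m).
Hypotheses (size_enc : forall x, size (enc x) = B) (encK : cancel enc dec).

(** Coins are drawn before the stream is seen, so there is one for every conceivable report; a site
    looks up the coin indexed by the report at hand. *)
Definition coins : finType := {ffun report n m -> bool}.

Definition coin_law (p : option 'I_k) (x : coins) : R :=
  \prod_y bernoulli (rate lam y) (x y).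

Lemma coin_law_ge0 p x : 0 <= coin_law p x.
Proof.
apply: prodr_ge0 => y _; rewrite /bernoulli.
by case: (x y); rewrite ?subr_ge0 ?rate_ge0 ?rate_le1.
Qed.

Lemma coin_law_sum1 p : \sum_x coin_law p x = 1.
Proof.
rewrite -(bigA_distr_bigA (fun y => bernoulli (rate lam y))) /=.
by apply: big1 => y _; rewrite big_bool /= addrC subrK.
Qed.

(** A site keeps its coins and its reversed history, the coordinator the list of decoded reports.
    One hop suffices because no message is ever answered. *)
Definition sampler : protocol R k n :=
  @Protocol R k n coins coin_law coin_law_ge0 coin_law_sum1
    (coins * seq 'I_n) (seq (report n m))
    (fun _ x => (x, [::])) (fun _ => [::])
    (fun _ st j => let y := report_of m j st.2 in
       ((st.1, j :: st.2), if st.1 y then enc y else [::]))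
    (fun _ st _ => (st, [::]))
    (fun st _ y => (dec y :: st, [::]))
    (fun st j => \sum_(x <- st | x.1.1 == j) (rate lam x)^-1)
    1.

Implicit Types (w : tape sampler) (s : stream k n).

Definition hits w s : seq (report n m) :=
  [seq e.2 | e <- reports m (rev s) & (w e.1 : coins) e.2].

Lemma run_sampler w s :
  [/\ forall i, sites (run w s) i = (w (Some i), local i (rev s)),
      Defs.coord (run w s) = hits w s,
      pending (run w s) = [::] &
      bits (run w s) = (B * size (hits w s))%N].
Proof.
elim/last_ind: s => [|s [i j] [IHs IHc IHp IHb]].
  by split=> //=; rewrite muln0.
rewrite /run foldl_rcons -/(run w s) /step /= IHs /= IHp /hits rev_rcons /=.
case: ifP => hit.
  (* A positive code length keeps [send] from dropping the report as silence. *)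
  have enc0 : enc (report_of m j (local i (rev s))) != [::].
    by rewrite -size_eq0 size_enc -lt0n.
  rewrite /deliver /send /= enc0 /= encK IHc IHb !size_enc; split=> //=.
    by move=> i'; rewrite /set_site local_cons eq_sym /= IHs; case: eqP => [->|].
  by rewrite !addn0 mulnS addnC.
rewrite /deliver /send /= IHb; split=> //=.
  by move=> i'; rewrite /set_site local_cons eq_sym /= IHs; case: eqP => [->|].
by rewrite !addn0.
Qed.

Lemma settles_sampler s : settles sampler s.
Proof. by move=> w t; case: (run_sampler w (take t s)). Qed.

Lemma expected_cost s : (size s <= m)%N ->
  Ex (fun w : tape sampler => (cost w s)%:R) <=
  B%:R * (lam * \sum_i harm R (sqsum (local i (rev s)))).
Proof.
move=> sm; rewrite -size_rev in sm.
apply: le_trans (ler_wpM2l (ler0n _ _) (reports_rate lam_gt0 sm)).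
rewrite le_eqVlt; apply/predU1P; left; rewrite /Ex.
(* The law of the tapes is the product law [weight] with the same rates for every party; linearity
   of expectation then gives each coin its rate. *)
transitivity (\sum_w weight (fun e => rate lam e.2) w *
  (B%:R * \sum_(e <- reports m (rev s)) ((w e.1 : coins) e.2 : nat)%:R)).
  apply: eq_bigr => w _; case: (run_sampler w s) => _ _ _ costE.
  rewrite /cost costE natrM; congr (_ * (_ * _)).
  by rewrite /hits size_map size_filter -sum1_count natr_sum big_mkcond;
     apply: eq_bigr => e _; case: (_ e.2).
under eq_bigr => w _ do rewrite mulrCA mulr_sumr.
rewrite -mulr_sumr exchange_big /=; congr (_ * _).
by apply: eq_bigr => e _; rewrite (sum_weight_hit (fun e => rate lam e.2)).
Qed.

(** Both numbers are sums over the potential reports of [j], with terms 1 and hit over rate; the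
    difference is a sum of centred terms. *)
Lemma estimate_error w s t j : (size s <= m)%N ->
  (freq s t j)%:R - estimate_at w s t j =
  - \sum_(e <- [seq e <- reports m (rev (take t s)) | e.2.1.1 == j])
      (((w e.1 : coins) e.2 : nat)%:R / rate lam e.2 - 1).
Proof.
move=> sm; case: (run_sampler w (take t s)) => _ coordE _ _.
rewrite /estimate_at coordE /= /hits big_map big_filter_cond big_filter sumrB.
rewrite opprB (reports_count R m); congr (_ - _).
  congr (_%:R); apply: eq_bigr => i _.
  by rewrite count_local /site_freq count_rev.
rewrite big_mkcondl; apply: eq_bigr => e _.
by case: (_ e.2); rewrite ?mul1r ?mul0r.
Qed.

Lemma ell2'_sqr s t :
  ell2' R s t ^+ 2 = \sum_i (sqsum (local i (rev (take t s))))%:R.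
Proof.
rewrite sqr_sqrtr; last first.
  by apply: sumr_ge0 => i _; apply: sumr_ge0 => j _; rewrite exprn_ge0.
apply: eq_bigr => i _; rewrite /sqsum natr_sum; apply: eq_bigr => j _.
by rewrite count_local /site_freq count_rev natrX.
Qed.

Lemma ell2'_gt0 s t : (0 < t)%N -> (t <= size s)%N -> 0 < ell2' R s t.
Proof.
move=> t0 ts; rewrite lt0r sqrtr_ge0 andbT -sqrf_eq0 ell2'_sqr.
case E: (rev (take t s)) => [|[i j] r].
  by move: t0; rewrite -(size_takel ts) -size_rev E.
rewrite -natr_sum pnatr_eq0 -lt0n (bigD1 i) //= local_cons eqxx sqsum_cons.
by rewrite addnS.
Qed.

Lemma accuracy (H eps : R) s t j :
  0 < eps -> (size s = m)%N -> (0 < t)%N -> (t <= m)%N ->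
  harm R m <= H -> 3 * H <= lam * eps ^+ 2 ->
  2 / 3 <= Pr (fun w : tape sampler =>
    `|(freq s t j)%:R - estimate_at w s t j| <= eps * ell2' R s t).
Proof.
move=> eps0 sm t0 tm Hm lamH.
have ell0 : 0 < ell2' R s t by rewrite ell2'_gt0 ?sm.
set r := rev (take t s).
have rm : (size r <= m)%N by rewrite size_rev size_take_min geq_min -sm leqnn orbT.
(* The failure probability 1/3 is the factor 3 in the assumption on [lam]. *)
have -> : 2 / 3 = 1 - 3^-1 :> R by lra.
apply: chebyshev_finite; first 1 last.
- rewrite -[RHS](sum_weight (fun e : option 'I_k * report n m => rate lam e.2)).
  exact: eq_bigr.
- exact: mulr_gt0.
- under eq_bigr => w _ do rewrite estimate_error ?sm // sqrrN.
  rewrite (sum_weight_square (q := fun e => rate lam e.2)); last 2 first.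
  + by rewrite filter_uniq // reports_uniq.
  + move=> e; rewrite mem_filter => /andP[_ /(reports_pos rm)[v0 f0]].
    by rewrite lt0r_neq0 ?rate_gt0.
  rewrite big_filter; apply: le_trans (reports_variance lam_gt0 j rm) _.
  rewrite ler_pdivrMr // exprMn ell2'_sqr -/r.
  apply: (@le_trans _ _ ((\sum_i (sqsum (local i r))%:R) * H)).
    rewrite mulr_suml; apply: ler_sum => i _; rewrite ler_wpM2l ?ler0n //.
    apply: le_trans Hm; apply: harm_homo; apply: leq_trans (count_size _ _) _.
    exact: leq_trans (size_local _ _) rm.
  have S0 : 0 <= \sum_i (sqsum (local i r))%:R :> R.
    by apply: sumr_ge0 => i _; rewrite ler0n.
  rewrite mulrCA -mulrA -mulrA mulrC -mulrA.
  have := ler_wpM2l S0 lamH; set S := \sum_i _; by lra.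
- by move=> w; apply: prodr_ge0 => p _; apply: coin_law_ge0.
Qed.

End Sampler.

(** * Size of a report and choice of the parameters *)

Lemma card_report (n m c : nat) : (1 < n)%N -> (m <= n ^ c)%N ->
  (#|{: report n m}| <= 2 ^ ((3 * c + 3) * up_log 2 n))%N.
Proof.
move=> n1 mn; rewrite !card_prod !card_ord.
(* One more factor [n >= 2] absorbs the successor; the components of a report then cost exponents
   [1], [c + 1] and [2 c + 1]. *)
have succ_le a b : (a <= n ^ b)%N -> (a.+1 <= n ^ b.+1)%N.
  move=> ab; have nb0 : (0 < n ^ b)%N by rewrite expn_gt0 ltnW.
  rewrite expnS (leq_trans (n := 2 * n ^ b)) // ?leq_mul2r ?n1 ?orbT //.
  by rewrite mul2n -addnn -add1n leq_add.
apply: (@leq_trans (n ^ (3 * c + 3))).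
  rewrite (_ : 3 * c + 3 = 1 + c.+1 + (2 * c).+1)%N; last by ring.
  rewrite !expnD expn1 !leq_mul // ?succ_le //.
  by rewrite mulnC expnM leq_sqr.
by rewrite [X in (_ <= 2 ^ X)%N]mulnC expnM leq_exp2r ?up_logP // addnS.
Qed.

Theorem theorem4 (R : realType) (c : nat) :
  exists C : R, 0 < C /\
  forall (k n m : nat) (eps : R),
    (0 < k)%N -> (1 < n)%N -> (m <= n ^ c)%N -> 0 < eps -> eps < 1 ->
    exists P : protocol R k n,
    forall s : stream k n, size s = m ->
      settles P s /\
      (forall (t : nat) (j : 'I_n), (1 <= t)%N -> (t <= m)%N ->
         2 / 3 <= Pr (fun w : tape P =>
           `|(freq s t j)%:R - estimate_at w s t j| <= eps * ell2' R s t)) /\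
      Ex (fun w : tape P => (cost w s)%:R)
        <= C * (k%:R / eps ^+ 2 * ln n%:R ^+ 3).
Proof.
have c0 : 0 <= c%:R :> R by exact: ler0n.
(* The factors come from [lam], the sum of [harm] over the sites and the report length, each
   contributing one [ln n]. *)
exists (3 * (c%:R + 4) * (2 * c%:R + 4) * (12 * c%:R + 12)).
split; first by rewrite !mulr_gt0 // ltr_wpDl // mulr_ge0.
move=> k n m eps k0 n1 mn eps0 _.
have n0 : (0 < n)%N := ltnW n1.
set H : R := 1 + c%:R * ln n%:R.
(* This turns additive constants into multiples of [ln n]. *)
have ln_ge : 1 <= 4 * ln n%:R :> R.
  by apply: le_trans (@up_log2_le_ln R n n1); rewrite ler1n up_log_gt0.
have ln0 : 0 <= ln n%:R :> R by lra.
have H0 : 0 < H by rewrite ltr_pwDl // mulr_ge0.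
set lam : R := 3 * H / eps ^+ 2.
have lam0 : 0 < lam by rewrite divr_gt0 ?mulr_gt0 ?exprn_gt0.
pose B := ((3 * c + 3) * up_log 2 n)%N.
have B0 : (0 < B)%N by rewrite muln_gt0 up_log_gt0 addnS.
have [enc [dec [size_enc encK]]] :=
  @block_code _ (Ordinal n0, ord0, ord0) _ (@card_report n m c n1 mn).
exists (@sampler R k n m lam lam0 enc dec) => s sm; split.
  exact: (settles_sampler B0 size_enc encK).
split=> [t j t1 tm|].
  apply: (accuracy lam0 B0 size_enc encK (H := H)) => //.
    exact: harm_exp.
  by rewrite /lam mulfVK // expf_neq0 // lt0r_neq0.
apply: le_trans (expected_cost lam0 B0 size_enc encK _) _; first by rewrite sm.
have harm_le : \sum_i harm R (sqsum (local i (rev s))) <=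
    k%:R * ((2 * c%:R + 4) * ln n%:R).
  rewrite mulr_natl -[X in _ *+ X](card_ord k) -sumr_const.
  apply: ler_sum => i _.
  apply: (@le_trans _ _ (1 + (2 * c)%:R * ln n%:R)); last by rewrite natrM; lra.
  apply: harm_exp => //; rewrite mulnC expnM.
  apply: leq_trans (sqsum_size _) _; rewrite leq_sqr.
  by apply: leq_trans (size_local _ _) _; rewrite size_rev sm.
have B_le : B%:R <= (12 * c%:R + 12) * ln n%:R :> R.
  rewrite /B natrM natrD natrM.
  have := @up_log2_le_ln R n n1; have := ler0n R (up_log 2 n).
  set u := _%:R => _ Hu.
  have -> : (12 * c%:R + 12) * ln n%:R = (3 * c%:R + 3) * (4 * ln n%:R) :> R by ring.
  by rewrite ler_wpM2l // addr_ge0 // mulr_ge0.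
have lam_le : lam <= 3 * (c%:R + 4) * ln n%:R / eps ^+ 2.
  by rewrite ler_pM2r ?invr_gt0 ?exprn_gt0 // /H; lra.
have sum0 : 0 <= \sum_i harm R (sqsum (local i (rev s))).
  by apply: sumr_ge0 => i _; apply: harm_ge0.
have prod0 : 0 <= lam * \sum_i harm R (sqsum (local i (rev s))).
  by rewrite mulr_ge0 // ltW.
apply: le_trans (ler_pM (ler0n _ B) prod0 B_le
  (ler_pM (ltW lam0) sum0 lam_le harm_le)) _.
by rewrite le_eqVlt; apply/predU1P; left; ring.
Qed.
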